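(* Let $A$ be a semiprime algebra of the variety $\mathcal{V}$ such that $K(A)$ is closed under the commutator operation. Then: (1) if $\theta$ is a max-regular congruence of $A$ then $\theta^{\ast}$ is a max-regular ideal of $L(A)$; (2) if $I$ is a max-regular ideal of $L(A)$ then $I_{\ast}$ is a max-regular congruence of $A$.
   Context: $\mathcal{V}$ is a fixed congruence-modular variety of algebras (of a finite signature) that is semidegenerate: no nontrivial algebra in $\mathcal{V}$ has one-element subalgebras (equivalently, $\nabla_A$ is compact in $Con(A)$ for every $A\in\mathcal{V}$). For $A\in\mathcal{V}$, $Con(A)$ is the complete lattice of congruences of $A$, with least element $\Delta_A$ and greatest element $\nabla_A$; $K(A)$ is the set of compact (= finitely generated) congruences. Commutator: $[\cdot,\cdot]=[\cdot,\cdot]_A$ is the (modular) commutator, i.e. the greatest operation on the congruence lattices of members of $\mathcal{V}$ such that for every surjective morphism $f:A\to B$ in $\mathcal{V}$ and all $\alpha,\beta\in Con(A)$: $[\alpha,\beta]_A\subseteq\alpha\cap\beta$ and $[\alpha,\beta]_A\vee Ker(f)=f^{-1}([f(\alpha\vee Ker(f)),f(\beta\vee Ker(f))]_B)$. $\phi\in Con(A)\setminus\{\nabla_A\}$ is prime if $[\alpha,\beta]\subseteq\phi$ implies $\alpha\subseteq\phi$ or $\beta\subseteq\phi$ (for $\alpha,\beta\in Con(A)$); $Spec(A)$ is the set of prime congruences; $\rho(\theta)=\bigcap\{\phi\in Spec(A)\mid\theta\subseteq\phi\}$; $A$ is semiprime if $\rho(\Delta_A)=\Delta_A$. Reticulation: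 when $K(A)$ is closed under the commutator, $L(A)=K(A)/{\equiv}$ where $\alpha\equiv\beta$ iff $\rho(\alpha)=\rho(\beta)$; $\lambda_A:K(A)\to L(A)$ is the quotient map; $L(A)$ is a bounded distributive lattice with $\lambda_A(\alpha)\vee\lambda_A(\beta)=\lambda_A(\alpha\vee\beta)$, $\lambda_A(\alpha)\wedge\lambda_A(\beta)=\lambda_A([\alpha,\beta])$, $0=\lambda_A(\Delta_A)$, $1=\lambda_A(\nabla_A)$. For $\theta\in Con(A)$, $\theta^{\ast}=\{\lambda_A(\alpha)\mid\alpha\in K(A),\alpha\subseteq\theta\}$, an ideal of $L(A)$; for an ideal $I$ of $L(A)$, $I_{\ast}=\bigvee\{\alpha\in K(A)\mid\lambda_A(\alpha)\in I\}\in Con(A)$. $B(Con(A))$ is the set of complemented elements of the lattice $Con(A)$. A congruence of $A$ is regular if it is the join of a family of elements of $B(Con(A))$; a max-regular congruence is a maximal element of the set of proper regular congruences of $A$. An ideal of a bounded distributive lattice $L$ is regular if it is generated by a set of complemented elements of $L$; a max-regular ideal is a maximal element of the set of proper regular ideals of $L$. *)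

(* Defs.v *)
From HB Require Import structures.
From mathcomp Require Import all_boot all_order.
From mathcomp Require Import generic_quotient boolp classical_sets cardinality.

Set Implicit Arguments.
Unset Strict Implicit.
Unset Printing Implicit Defensive.

Import Order.TTheory.
Local Open Scope classical_set_scope.
Local Open Scope order_scope.

#[local] Obligation Tactic := idtac.

Section LatticeIdeals.
Context {d : Order.disp_t}.

Definition complemented (L : tbLatticeType d) : set L :=
  [set x | exists y : L, x `&` y = \bot /\ x `|` y = \top].

Variable L : tbDistrLatticeType d.

Definition ideal (I : set L) : Prop :=
  [/\ I \bot,
      forall x y, I x -> I y -> I (x `|` y)
    & forall x y, x <= y -> I y -> I x].

Definition ideal_gen (X : set L) : set L :=
  [set x | forall J, ideal J -> subset X J -> J x].

Definition regular_ideal (I : set L) : Prop :=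
  exists2 X : set L, subset X (complemented (L := L)) & I = ideal_gen X.

Definition proper_regular_ideal (I : set L) : Prop :=
  regular_ideal I /\ I <> setT.

Definition max_regular_ideal (I : set L) : Prop :=
  proper_regular_ideal I /\
  forall J, proper_regular_ideal J -> subset I J -> J = I.

End LatticeIdeals.

Record signature := Signature { symbol : finType; arity : symbol -> nat }.

Record algebra (S : signature) := Algebra {
  carrier :> Type;
  op : forall o : symbol S, ('I_(arity o) -> carrier) -> carrier;
  carrier_nonempty : inhabited carrier
}.
Arguments op {S a} o _.

Inductive term (S : signature) : Type :=
| Var of nat
| App (o : symbol S) of 'I_(arity o) -> term S.
Arguments Var {S} _.

Fixpoint eval (S : signature) (A : algebra S) (v : nat -> A) (t : term S) : A :=
  match t with
  | Var i => v i
  | App o ts => op o (fun i => eval v (ts i))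
  end.

Definition models (S : signature) (E : set (term S * term S))
  : algebra S -> Prop :=
  fun A => forall e, E e -> forall v : nat -> A, eval v e.1 = eval v e.2.

Definition variety (S : signature) (V : algebra S -> Prop) : Prop :=
  exists E, forall A, V A <-> models E A.

Definition subuniverse (S : signature) (A : algebra S) (B : set A) : Prop :=
  forall (o : symbol S) (a : 'I_(arity o) -> A),
    (forall i, B (a i)) -> B (op o a).

Definition semidegenerate (S : signature) (V : algebra S -> Prop) : Prop :=
  forall A, V A -> (exists x y : A, x <> y) ->
    forall e : A, ~ subuniverse [set e].

Record hom (S : signature) (A B : algebra S) := Hom {
  hom_fun :> A -> B;
  hom_op : forall (o : symbol S) (a : 'I_(arity o) -> A),
    hom_fun (op o a) = op o (fun i => hom_fun (a i))
}.

Definition surjective_hom (S : signature) (A B : algebra S) (f : hom A B) :=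
  forall b, exists a, f a = b.

Record congruence (S : signature) (A : algebra S) := Congruence {
  con_rel :> A -> A -> Prop;
  con_refl : forall x, con_rel x x;
  con_sym : forall x y, con_rel x y -> con_rel y x;
  con_trans : forall x y z, con_rel x y -> con_rel y z -> con_rel x z;
  con_op : forall (o : symbol S) (a b : 'I_(arity o) -> A),
    (forall i, con_rel (a i) (b i)) -> con_rel (op o a) (op o b)
}.

HB.instance Definition _ (S : signature) (A : algebra S) :=
  gen_eqMixin (congruence A).
HB.instance Definition _ (S : signature) (A : algebra S) :=
  gen_choiceMixin (congruence A).

Fact con_display : Order.disp_t. Proof. exact: Order.Disp tt tt. Qed.

Section CongruenceLattice.
Variables (S : signature) (A : algebra S).
Implicit Types (alpha beta gamma : congruence A) (D : set (congruence A)).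

Lemma con_ext alpha beta :
  (forall x y, alpha x y <-> beta x y) -> alpha = beta.
Proof.
case: alpha beta => [r r1 r2 r3 r4] [s s1 s2 s3 s4] /= rs.
have ers : r = s by apply/funext => x; apply/funext => y; apply/propext.
by subst s; congr Congruence; apply: Prop_irrelevance.
Qed.

Definition con_le alpha beta : bool := `[< forall x y, alpha x y -> beta x y >].

Lemma con_le_refl : reflexive con_le.
Proof. by move=> a; apply/asboolP. Qed.

Lemma con_le_anti : antisymmetric con_le.
Proof.
move=> a b /andP[/asboolP ab /asboolP ba].
by apply: con_ext => x y; split; [apply: ab | apply: ba].
Qed.

Lemma con_le_trans : transitive con_le.
Proof.
by move=> b a c /asboolP ab /asboolP bc; apply/asboolP => x y /ab /bc.
Qed.

HB.instance Definition _ := Order.Le_isPOrder.Build con_display (congruence A)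
  con_le_refl con_le_anti con_le_trans.

Lemma con_leP alpha beta :
  reflect (forall x y, alpha x y -> beta x y) (alpha <= beta).
Proof. exact: asboolP. Qed.

Program Definition con_bot : congruence A := @Congruence S A eq _ _ _ _.
Next Obligation. by []. Qed.
Next Obligation. by move=> x y ->. Qed.
Next Obligation. by move=> x y z -> ->. Qed.
Next Obligation.
by move=> o a b ab; congr op; apply/funext => i; apply: ab.
Qed.

Program Definition con_top : congruence A :=
  @Congruence S A (fun _ _ => True) _ _ _ _.
Next Obligation. by []. Qed.
Next Obligation. by []. Qed.
Next Obligation. by []. Qed.
Next Obligation. by []. Qed.

Program Definition con_inf D : congruence A :=
  @Congruence S A (fun x y => forall t, D t -> t x y) _ _ _ _.
Next Obligation. by move=> D x t _; apply: con_refl. Qed.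
Next Obligation. by move=> D x y xy t Dt; apply: con_sym; apply: xy. Qed.
Next Obligation.
by move=> D x y z xy yz t Dt; apply: con_trans (xy _ Dt) (yz _ Dt).
Qed.
Next Obligation.
by move=> D o a b ab t Dt; apply: con_op => i; apply: ab.
Qed.

Definition con_gen (R : A -> A -> Prop) : congruence A :=
  con_inf [set t : congruence A | forall x y, R x y -> t x y].

Definition con_sup D : congruence A :=
  con_gen (fun x y => exists2 t, D t & t x y).

Lemma con_supP D beta :
  (con_sup D <= beta) <-> (forall t, D t -> t <= beta).
Proof.
split=> [/con_leP Db t Dt|Db].
  by apply/con_leP => x y xy; apply: Db => s; apply; exists t.
by apply/con_leP => x y; apply => u v [t /Db /con_leP tb]; apply: tb.
Qed.

Lemma con_infP D beta :
  (beta <= con_inf D) <-> (forall t, D t -> beta <= t).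
Proof.
split=> [/con_leP bD t Dt|bD].
  by apply/con_leP => x y /bD; apply.
by apply/con_leP => x y xy t /bD /con_leP; apply.
Qed.

Definition con_meet alpha beta := con_inf [set alpha; beta].
Definition con_join alpha beta := con_sup [set alpha; beta].

Lemma con_lexI a b c : (a <= con_meet b c) = (a <= b) && (a <= c).
Proof.
apply/idP/andP => [/con_infP H|[ab ac]].
  by split; apply: H; [left|right].
by apply/con_infP => t [->|->].
Qed.

Lemma con_leUx a b c : (con_join a b <= c) = (a <= c) && (b <= c).
Proof.
apply/idP/andP => [/con_supP H|[ab ac]].
  by split; apply: H; [left|right].
by apply/con_supP => t [->|->].
Qed.

Lemma con_le0x a : con_bot <= a.
Proof. by apply/con_leP => x y ->; apply: con_refl. Qed.

Lemma con_lex1 a : a <= con_top.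
Proof. exact/con_leP. Qed.

HB.instance Definition _ :=
  @Order.POrder_isMeetSemilattice.Build con_display (congruence A)
    con_meet con_lexI.
HB.instance Definition _ :=
  @Order.POrder_isJoinSemilattice.Build con_display (congruence A)
    con_join con_leUx.
HB.instance Definition _ :=
  @Order.hasBottom.Build con_display (congruence A) con_bot con_le0x.
HB.instance Definition _ :=
  @Order.hasTop.Build con_display (congruence A) con_top con_lex1.

Definition compact : set (congruence A) :=
  [set alpha | forall D, alpha <= con_sup D ->
    exists F, [/\ finite_set F, subset F D & alpha <= con_sup F]].

Definition regular_congruence alpha : Prop :=
  exists2 D, subset D (complemented (L := congruence A)) & alpha = con_sup D.

Definition proper_regular_congruence alpha : Prop :=
  regular_congruence alpha /\ alpha <> \top.

Definition max_regular_congruence alpha : Prop :=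
  proper_regular_congruence alpha /\
  forall beta, proper_regular_congruence beta -> alpha <= beta -> beta = alpha.

Lemma con_sup_finite D x y : con_sup D x y ->
  exists F, [/\ finite_set F, subset F D & con_sup F x y].
Proof.
have mono (F G : set (congruence A)) u v :
    subset F G -> con_sup F u v -> con_sup G u v.
  move=> FG; apply/con_leP/con_supP => t /FG Gt.
  by apply/con_leP => p q pq s; apply; exists t.
pose R u v := exists F, [/\ finite_set F, subset F D & con_sup F u v].
have Rrefl u : R u u.
  by exists set0; split => //; apply: con_refl.
have Rsym u v : R u v -> R v u.
  by move=> [F [? ? /con_sym ?]]; exists F.
have Rtrans u v w : R u v -> R v w -> R u w.
  move=> [F [F1 F2 F3]] [G [G1 G2 G3]]; exists (setU F G); split.
  - by rewrite finite_setU.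
  - by move=> t [/F2|/G2].
  - apply: (con_trans (y := v)).
    + by apply: mono F3 => t ?; left.
    + by apply: mono G3 => t ?; right.
have Rop o (a b : 'I_(arity o) -> A) :
    (forall i, R (a i) (b i)) -> R (op o a) (op o b).
  move=> /choice[F FP]; exists (\bigcup_i F i); split.
  - by apply: bigcup_finite => [|i _]; [apply: finite_finset|case: (FP i)].
  - by move=> t [i _]; case: (FP i) => _ + _; apply.
  - apply: con_op => i; case: (FP i) => _ _; apply: mono => t Ft.
    by exists i.
pose c := Congruence Rrefl Rsym Rtrans Rop.
move=> Dxy; apply: (Dxy c) => u v [t Dt tuv].
exists [set t]; split; [exact: finite_set1|by move=> _ ->|].
by move=> s; apply; exists t.
Qed.

Lemma con_sup_mono D E : subset D E -> con_sup D <= con_sup E.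
Proof.
move=> DE; apply/con_supP => t /DE Et; move: t Et; exact/con_supP.
Qed.

Lemma compact_bot : compact \bot.
Proof. by move=> D _; exists set0; split => //; apply: le0x. Qed.

Lemma compact_join a b : compact a -> compact b -> compact (a `|` b).
Proof.
move=> ca cb D; rewrite leUx => /andP[/ca[F [F1 F2 F3]] /cb[G [G1 G2 G3]]].
exists (setU F G); split.
- by rewrite finite_setU.
- by move=> t [/F2|/G2].
- rewrite leUx (le_trans F3) ?(le_trans G3) //; apply: con_sup_mono => t ?.
    by right.
  by left.
Qed.

Lemma compact_con_gen (I : finType) (p q : I -> A) :
  compact (con_gen (fun x y => exists2 i, x = p i & y = q i)).
Proof.
move=> D /con_leP le.
have H i : con_sup D (p i) (q i) by apply: le => t; apply; exists i.
have /choice[F FP] i := con_sup_finite (H i).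
exists (\bigcup_i F i); split.
- by apply: bigcup_finite => [|i _]; [apply: finite_finset|case: (FP i)].
- by move=> t [i _]; case: (FP i) => _ + _; apply.
- apply/con_leP => x y; apply => _ _ [i -> ->].
  case: (FP i) => _ _; apply/con_leP; apply: con_sup_mono => t Ft.
  by exists i.
Qed.

End CongruenceLattice.

Arguments compact {S} A.
Arguments con_inf : simpl never.
Arguments con_gen : simpl never.
Arguments con_sup : simpl never.

Definition congruence_modular (S : signature) (V : algebra S -> Prop) : Prop :=
  forall A, V A -> forall alpha beta gamma : congruence A,
    alpha <= gamma -> (alpha `|` beta) `&` gamma = alpha `|` (beta `&` gamma).

Section Quotient.
Variables (S : signature) (A : algebra S) (t : congruence A).

Definition quot_carrier : Type := {X : A -> Prop | exists a, X = t a}.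
Definition quot_pi (a : A) : quot_carrier :=
  exist _ (con_rel t a) (ex_intro _ a erefl).
Definition quot_repr (x : quot_carrier) : A := projT1 (cid (proj2_sig x)).

Lemma quot_piP a b : quot_pi a = quot_pi b <-> t a b.
Proof.
split=> [[e]|ab]; first by rewrite e; apply: con_refl.
apply: eq_exist => /=; apply/funext => c; apply/propext; split.
  by apply: con_trans; apply: con_sym.
exact: con_trans.
Qed.

Lemma quot_reprK x : quot_pi (quot_repr x) = x.
Proof.
by case: x => X XP; apply: eq_exist; rewrite /quot_repr /=; case: (cid XP).
Qed.

Lemma quot_nonempty : inhabited quot_carrier.
Proof. by case: (carrier_nonempty A) => a; split; apply: quot_pi a. Qed.

Definition quot : algebra S := {|
  carrier := quot_carrier;
  op := fun o a => quot_pi (op o (fun i => quot_repr (a i)));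
  carrier_nonempty := quot_nonempty |}.

Lemma quot_pi_op (o : symbol S) (a : 'I_(arity o) -> A) :
  quot_pi (op o a) = op o (fun i => quot_pi (a i) : quot).
Proof.
by apply/quot_piP; apply: con_op => i; apply/quot_piP; rewrite quot_reprK.
Qed.

Definition quot_hom : hom A quot := @Hom S A quot quot_pi quot_pi_op.

End Quotient.

Lemma eval_hom (S : signature) (A B : algebra S) (f : hom A B)
  (v : nat -> A) (s : term S) : f (eval v s) = eval (fun n => f (v n)) s.
Proof.
by elim: s => //= o ts IH; rewrite hom_op; congr op; apply/funext => i.
Qed.

Lemma variety_quot (S : signature) (V : algebra S -> Prop) (A : algebra S)
  (t : congruence A) : variety V -> V A -> V (quot t).
Proof.
move=> [E VE] /VE EA; apply/VE => e Ee v.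
have -> : v = fun n => quot_hom t (quot_repr (v n)).
  by apply/funext => n /=; rewrite quot_reprK.
by rewrite -!eval_hom EA.
Qed.

Lemma compact_nabla (S : signature) (V : algebra S -> Prop) (A : algebra S) :
  variety V -> semidegenerate V -> V A -> compact A \top.
Proof.
move=> vV sV VA; case: (carrier_nonempty A) => e.
pose p (o : symbol S) := op o (fun=> e) : A.
pose t := con_gen (fun x y => exists2 o : symbol S, x = p o & y = e).
suff <- : t = \top by exact: (@compact_con_gen S A (symbol S) p (fun=> e)).
apply: con_ext => x y; split=> // _; apply: contrapT => ntxy.
have VQ := variety_quot t vV VA.
have /sV-/(_ VQ (quot_pi t e)) : exists x y : quot t, x <> y.
  by exists (quot_pi t x), (quot_pi t y) => /quot_piP.
apply=> o a ae; have -> : a = fun=> quot_pi t e by apply/funext.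
have <- := quot_pi_op t (fun _ : 'I_(arity o) => e).
by apply/quot_piP => s; apply; exists o.
Qed.

Section HomCongruences.
Variables (S : signature) (A B : algebra S) (f : hom A B).

Program Definition con_preim (beta : congruence B) : congruence A :=
  @Congruence S A (fun x y => beta (f x) (f y)) _ _ _ _.
Next Obligation. by move=> beta x; apply: con_refl. Qed.
Next Obligation. by move=> beta x y; apply: con_sym. Qed.
Next Obligation. by move=> beta x y z; apply: con_trans. Qed.
Next Obligation.
by move=> beta o a b ab /=; rewrite !hom_op; apply: con_op.
Qed.

Definition hom_ker : congruence A := con_preim \bot.

(* Generated by the direct image of alpha, and equal to that direct image when
   f is surjective and hom_ker <= alpha: see con_imE. *)
Definition con_im (alpha : congruence A) : congruence B :=
  con_gen (fun u v => exists x y, [/\ alpha x y, f x = u & f y = v]).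

Lemma con_imE (alpha : congruence A) : surjective_hom f -> hom_ker <= alpha ->
  forall u v,
    con_im alpha u v <-> exists x y, [/\ alpha x y, f x = u & f y = v].
Proof.
move=> fs /con_leP ka u v; split; last by move=> H t; apply.
pose R u v := exists x y, [/\ alpha x y, f x = u & f y = v].
have Rrefl w : R w w.
  by have [x <-] := fs w; exists x, x; split=> //; apply: con_refl.
have Rsym w z : R w z -> R z w.
  by move=> [x [y [xy <- <-]]]; exists y, x; split=> //; apply: con_sym.
have Rtrans w z s : R w z -> R z s -> R w s.
  move=> [x [y [xy <- yz]]] [x' [y' [xy' xz <-]]]; exists x, y'; split=> //.
  apply: (con_trans xy); apply: (con_trans _ xy').
  by apply: ka; rewrite /= yz xz.
have Rop o (a b : 'I_(arity o) -> B) :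
    (forall i, R (a i) (b i)) -> R (op o a) (op o b).
  move=> /choice[x /choice[y xy]]; exists (op o x), (op o y).
  split; first by apply: con_op => i; case: (xy i).
    by rewrite hom_op; congr op; apply/funext => i; case: (xy i).
  by rewrite hom_op; congr op; apply/funext => i; case: (xy i).
by move/(_ (Congruence Rrefl Rsym Rtrans Rop)); apply.
Qed.

End HomCongruences.

Section Commutator.
Variables (S : signature) (V : algebra S -> Prop).

Definition con_operation :=
  forall A : algebra S, congruence A -> congruence A -> congruence A.

Definition commutator_axioms (C : con_operation) : Prop :=
  forall (A B : algebra S) (f : hom A B), V A -> V B -> surjective_hom f ->
  forall alpha beta : congruence A,
    C A alpha beta <= alpha `&` beta /\
    C A alpha beta `|` hom_ker f =
      con_preim f (C B (con_im f (alpha `|` hom_ker f))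
                       (con_im f (beta `|` hom_ker f))).

Definition greatest_commutator (C : con_operation) : Prop :=
  commutator_axioms C /\
  forall C', commutator_axioms C' ->
    forall A, V A -> forall alpha beta, C' A alpha beta <= C A alpha beta.

(* The pointwise join of all operations satisfying the axioms; it is itself
   the greatest such operation, see commutatorP. *)
Definition commutator : con_operation := fun A alpha beta =>
  con_sup [set gamma | exists2 C, commutator_axioms C & gamma = C A alpha beta].

Lemma id_hom_axioms (A : algebra S) : exists f : hom A A, surjective_hom f.
Proof. by exists (@Hom S A A id (fun _ _ => erefl)) => b; exists b. Qed.

Lemma commutator_ub C A alpha beta :
  commutator_axioms C -> C A alpha beta <= commutator alpha beta.
Proof.
move=> CC; have /con_supP := lexx (commutator alpha beta).
by apply; exists C.
Qed.

Lemma commutator_leI A alpha beta : V A ->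
  @commutator A alpha beta <= alpha `&` beta.
Proof.
move=> VA; apply/con_supP => _ [C CC ->].
by have [f fs] := id_hom_axioms A; case: (CC A A f VA VA fs alpha beta).
Qed.

Lemma bot_axioms : commutator_axioms (fun A _ _ => \bot).
Proof. by move=> A B f _ _ _ alpha beta; rewrite le0x join0x. Qed.

Lemma commutatorP : greatest_commutator commutator.
Proof.
split; last by move=> C CC A _ alpha beta; apply: commutator_ub.
move=> A B f VA VB fs alpha beta; split; first exact: commutator_leI.
set a' := con_im _ _; set b' := con_im _ _.
apply/le_anti/andP; split.
  rewrite leUx; apply/andP; split.
    apply/con_supP => _ [C CC ->].
    have [_ e] := CC A B f VA VB fs alpha beta.
    apply: (le_trans (leUl _ (hom_ker f))); rewrite e; apply/con_leP => x y.
    exact: (con_leP _ _ (commutator_ub a' b' CC)).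
  apply/con_leP => x y xy; have e : f x = f y := xy.
  suff : commutator a' b' (f x) (f y) by [].
  by rewrite e; exact: con_refl.
set k := _ `|` _.
have kk : hom_ker f <= k by apply: leUr.
have sub : commutator a' b' <= con_im f k.
  apply/con_supP => _ [C CC ->].
  have [_ e] := CC A B f VA VB fs alpha beta.
  apply/con_leP => u v; have [x <-] := fs u; have [y <-] := fs v => xy.
  apply/(con_imE fs kk); exists x, y; split=> //.
  suff : C A alpha beta `|` hom_ker f <= k.
    by move/con_leP; apply; rewrite e.
  by rewrite leU2 // commutator_ub.
apply/con_leP => x y xy.
have /(con_imE fs kk)[x' [y' [k' ex ey]]] := con_leP _ _ sub _ _ xy.
have H z z' : f z = f z' -> k z z' by move=> e; apply: (con_leP _ _ kk).
by apply: con_trans (con_trans k' _); apply: H.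
Qed.

End Commutator.

Fact ret_display : Order.disp_t. Proof. exact: Order.Disp tt tt. Qed.

Section Reticulation.
Variables (S : signature) (V : algebra S -> Prop) (A : algebra S).
Implicit Types (alpha beta theta phi : congruence A).

Local Notation comm := (@commutator S V A).

Definition prime_congruence phi : Prop :=
  phi <> \top /\
  forall alpha beta, comm alpha beta <= phi -> alpha <= phi \/ beta <= phi.

Definition radical theta : congruence A :=
  con_inf [set phi | prime_congruence phi /\ theta <= phi].

Definition semiprime : Prop := radical \bot = \bot.

Definition compact_commutator : Prop :=
  forall alpha beta,
    compact A alpha -> compact A beta -> compact A (comm alpha beta).

Lemma radical_le theta alpha : radical theta <= radical alpha <->
  forall phi, prime_congruence phi -> alpha <= phi -> theta <= phi.
Proof.
split=> [ta phi phiP aphi|H].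
  apply: (@le_trans _ _ (radical theta)).
    by apply/con_infP => t [].
  by apply: (le_trans ta); move: (lexx (radical alpha)) => /con_infP; apply.
apply/con_infP => phi [phiP aphi].
by move: (lexx (radical theta)) => /con_infP; apply; split=> //; apply: H.
Qed.

Hypotheses (AV : V A) (KC : compact_commutator) (K1 : compact A \top).

Definition kcon : Type := {alpha : congruence A | alpha \in compact A}.
HB.instance Definition _ := Choice.on kcon.

Definition kmk alpha (ca : compact A alpha) : kcon := exist _ alpha (mem_set ca).

Lemma kconP (a : kcon) : compact A (val a).
Proof. exact: set_mem (valP a). Qed.
Arguments kconP : clear implicits.

Definition kcomm (a b : kcon) : kcon :=
  kmk (KC (kconP a) (kconP b)).
Definition kjoin (a b : kcon) : kcon :=
  kmk (@compact_join _ _ _ _ (kconP a) (kconP b)).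
Definition kbot : kcon := kmk (@compact_bot S A).
Definition ktop : kcon := kmk K1.

Definition kequiv (a b : kcon) : bool := radical (val a) == radical (val b).

Lemma kequiv_equiv : equiv_class_of kequiv.
Proof.
split=> [a|a b|b a c]; rewrite /kequiv ?eqxx 1?eq_sym//.
by move=> /eqP-> /eqP->.
Qed.

Canonical kequiv_rel := EquivRelPack kequiv_equiv.

(* The three hypotheses do not affect the carrier; they are recorded in the type
   so that the bounded lattice structure below can be inferred from it. *)
Definition reticulation
    (_ : V A) (_ : compact_commutator) (_ : compact A \top) : Type :=
  {eq_quot kequiv_rel}%qT.

Local Notation L := (reticulation AV KC K1).

HB.instance Definition _ := EqQuotient.on L.
HB.instance Definition _ := Choice.on L.

Definition lambda (a : kcon) : L := (\pi_L a)%qT.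

Lemma lambda_eqP (a b : kcon) :
  lambda a = lambda b <-> radical (val a) = radical (val b).
Proof.
rewrite /lambda; split=> [/eqmodP/eqP//|e].
by apply/eqmodP/eqP.
Qed.

Lemma radical_repr (a : kcon) : radical (val (repr (lambda a))) = radical (val a).
Proof. by apply/lambda_eqP; rewrite /lambda reprK. Qed.

Lemma radical_eq (alpha beta : congruence A) :
  (radical alpha <= radical beta) -> (radical beta <= radical alpha) ->
  radical alpha = radical beta.
Proof. by move=> ab ba; apply/le_anti/andP. Qed.

Lemma prime_comm phi alpha beta : prime_congruence phi ->
  comm alpha beta <= phi <-> alpha <= phi \/ beta <= phi.
Proof.
move=> [_ P]; split; first exact: P.
by move=> H; apply: le_trans (commutator_leI _ _ AV) _; rewrite leIx2//;
  apply/orP.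
Qed.

Definition ret_le (x y : L) : bool :=
  radical (val (repr x)) <= radical (val (repr y)).
Definition ret_join (x y : L) : L := lambda (kjoin (repr x) (repr y)).
Definition ret_meet (x y : L) : L := lambda (kcomm (repr x) (repr y)).

Lemma ret_leP (x y : L) : reflect
  (forall phi, prime_congruence phi -> val (repr y) <= phi ->
    val (repr x) <= phi) (ret_le x y).
Proof. by apply: (iffP idP) => /radical_le. Qed.

Lemma ret_le_refl : reflexive ret_le.
Proof. by move=> x; apply: lexx. Qed.

Lemma ret_le_anti : antisymmetric ret_le.
Proof.
move=> x y /andP[xy yx]; rewrite -[x]reprK -[y]reprK.
exact/lambda_eqP/radical_eq.
Qed.

Lemma ret_le_trans : transitive ret_le.
Proof. by move=> y x z; apply: le_trans. Qed.

HB.instance Definition _ := Order.Le_isPOrder.Build ret_display L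
  ret_le_refl ret_le_anti ret_le_trans.

Lemma prime_lambda phi (a : kcon) : prime_congruence phi ->
  (val (repr (lambda a)) <= phi) = (val a <= phi).
Proof.
move=> P; have e := radical_repr a.
by apply/idP/idP; apply: (radical_le _ _).1 => //; rewrite e.
Qed.

Lemma ret_lexI (x y z : L) : (x <= ret_meet y z) = (x <= y) && (x <= z).
Proof.
apply/idP/andP => [/ret_leP H|[/ret_leP xy /ret_leP xz]].
  by split; apply/ret_leP => phi P h; apply: H => //; rewrite prime_lambda//;
    apply/prime_comm; rewrite // h; [left|right].
apply/ret_leP => phi P; rewrite prime_lambda// => /(prime_comm _ _ P).
by case; [apply: xy | apply: xz].
Qed.

Lemma ret_leUx (x y z : L) : (ret_join x y <= z) = (x <= z) && (y <= z).
Proof.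
apply/idP/andP => [/ret_leP H|[/ret_leP xz /ret_leP yz]].
  by split; apply/ret_leP => phi P /(H _ P); rewrite prime_lambda//= leUx;
    case/andP.
by apply/ret_leP => phi P h; rewrite prime_lambda//= leUx xz// yz.
Qed.

Lemma ret_le0x (x : L) : lambda kbot <= x.
Proof. by apply/ret_leP => phi P _; rewrite prime_lambda//= le0x. Qed.

Lemma ret_lex1 (x : L) : x <= lambda ktop.
Proof.
apply/ret_leP => phi P; rewrite prime_lambda//= => h.
exact: le_trans (lex1 _) h.
Qed.

HB.instance Definition _ :=
  @Order.POrder_isMeetSemilattice.Build ret_display L ret_meet ret_lexI.
HB.instance Definition _ :=
  @Order.POrder_isJoinSemilattice.Build ret_display L ret_join ret_leUx.

Lemma ret_meetUl :
  @left_distributive L L (@Order.meet _ L) (@Order.join _ L).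
Proof.
move=> x y z; apply/le_anti/andP; split; last first.
  by rewrite leUx !leI2// ?leUl ?leUr.
apply/ret_leP => phi P; rewrite !prime_lambda//= leUx !prime_lambda//=.
move=> /andP[/(prime_comm _ _ P) xz /(prime_comm _ _ P) yz].
apply/(prime_comm _ _ P); rewrite prime_lambda//= leUx.
by case: xz => [xp|]; [case: yz => [->|]; [left; rewrite xp|right] | right].
Qed.

HB.instance Definition _ :=
  @Order.Lattice_Meet_isDistrLattice.Build ret_display L ret_meetUl.
HB.instance Definition _ :=
  @Order.hasBottom.Build ret_display L (lambda kbot) ret_le0x.
HB.instance Definition _ :=
  @Order.hasTop.Build ret_display L (lambda ktop) ret_lex1.

Lemma lambda_join (a b : kcon) : lambda a `|` lambda b = lambda (kjoin a b).
Proof.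
apply/le_anti/andP; split; apply/ret_leP => phi P;
  by rewrite !prime_lambda//= !leUx !prime_lambda.
Qed.

Lemma lambda_meet (a b : kcon) : lambda a `&` lambda b = lambda (kcomm a b).
Proof.
apply/le_anti/andP; split; apply/ret_leP => phi P;
  rewrite !prime_lambda//= => /(prime_comm _ _ P) h; apply/(prime_comm _ _ P);
  by move: h; rewrite !prime_lambda.
Qed.

Lemma lambda_bot : \bot = lambda kbot. Proof. by []. Qed.
Lemma lambda_top : \top = lambda ktop. Proof. by []. Qed.

Definition upper_star theta : set L :=
  [set x | exists2 a : kcon, val a <= theta & x = lambda a].

Definition lower_star (I : set L) : congruence A :=
  con_sup [set alpha | exists2 a : kcon, I (lambda a) & alpha = val a].

End Reticulation.

Arguments upper_star {S V A} AV KC K1 theta.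
Arguments lower_star {S V A AV KC K1} I.

(* Main.v *)
Require Import Defs.
From mathcomp Require Import all_boot all_order.
From mathcomp Require Import boolp classical_sets cardinality.
From Stdlib Require Import Relation_Operators.

Set Implicit Arguments.
Unset Strict Implicit.
Unset Printing Implicit Defensive.

Import Order.TTheory.
Local Open Scope classical_set_scope.
Local Open Scope order_scope.

(** The two star maps are mutually inverse isotone bijections between the regular
    congruences of [A] and the regular ideals of [L(A)], and they match the
    improper ones; hence they preserve maximality among the proper ones.

    The bijection rests on three facts about a complemented congruence [e].  It is
    compact ([complemented_compact]), because the top congruence is compact and
    [Con(A)] is modular.  It equals its radical ([complemented_radical]), because
    in a semiprime algebra a congruence is trivial as soon as every prime contains
    it.  And a compact congruence is complemented exactly when its class in [L(A)]
    is ([lambda_complemented]); since [L(A)] is distributive, complemented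
    congruences are therefore closed under finite joins.  So a regular congruence
    is a directed join of complemented ones, and a compact congruence below it is
    below one of them; regular ideals behave in the same way.

    Lifting complements from [L(A)] to [Con(A)] requires that a congruence which
    lies in no prime be the top one.  As the top congruence is compact, it suffices
    that maximal congruences be prime, and this follows once it is known that no
    nontrivial algebra of the variety is abelian.  The commutator here is the
    greatest operation with the homomorphism property, so a lower bound for it
    is an explicit operation with that property, namely the term condition
    commutator ([mat_commutator_axioms]).  The one delicate point is the
    symmetry of the term condition ([weakly_centralizes_sym]), which follows from
    the modular law in the congruence lattice of the algebra of matrices.
    Finally, for an abelian algebra [Q] the diagonal of the
    square of [Q] is a congruence class, which yields a quotient of the square
    with a one-element subalgebra; semidegeneracy then makes [Q] trivial
    ([abelian_trivial]). *)

(** * Congruences generated by chains *)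

Section LatticeOperations.
Variables (S : signature) (B : algebra S).
Implicit Types (a b : congruence B).

Lemma con_meetE a b x y : (a `&` b) x y <-> a x y /\ b x y.
Proof.
split=> [ab|[ax bx] t]; last by case=> ->.
by split; apply: ab; [left|right].
Qed.

Lemma con_joinl a b x y : a x y -> (a `|` b) x y.
Proof. exact: (con_leP _ _ (leUl a b)). Qed.

Lemma con_joinr a b x y : b x y -> (a `|` b) x y.
Proof. exact: (con_leP _ _ (leUr b a)). Qed.

End LatticeOperations.

Section Translations.
Variables (S : signature) (A : algebra S).

Definition update n (a : 'I_n -> A) (i : 'I_n) (x : A) : 'I_n -> A :=
  fun j => if j == i then x else a j.

(** Closure under translations in one coordinate, unlike compatibility with the
    operations in all coordinates at once, passes to unions of relations; it
    still suffices for the generated equivalence to be a congruence. *)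
Definition translation_closed (G : A -> A -> Prop) : Prop :=
  forall (o : symbol S) (a : 'I_(arity o) -> A) i x y,
    G x y -> G (op o (update a i x)) (op o (update a i y)).

Lemma compatible_translation_closed (G : A -> A -> Prop) :
  (forall x, G x x) ->
  (forall (o : symbol S) (a b : 'I_(arity o) -> A),
    (forall i, G (a i) (b i)) -> G (op o a) (op o b)) ->
  translation_closed G.
Proof.
move=> Gxx Gop o a i x y xy; apply: Gop => j; rewrite /update.
by case: (j == i).
Qed.

Lemma rst_translation (G : A -> A -> Prop) : translation_closed G ->
  translation_closed (clos_refl_sym_trans A G).
Proof.
move=> Gt o a i x y; elim=> {x y} [x y xy|x|x y _|x y z _ xy _].
- exact/rst_step/Gt.
- exact: rst_refl.
- exact: rst_sym.
- exact: rst_trans.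
Qed.

(** Operations have finite arity, so the arguments can be exchanged one at a
    time, each exchange being a chain of translates. *)
Lemma rst_op (G : A -> A -> Prop) : translation_closed G ->
  forall (o : symbol S) (a b : 'I_(arity o) -> A),
    (forall i, clos_refl_sym_trans A G (a i) (b i)) ->
    clos_refl_sym_trans A G (op o a) (op o b).
Proof.
move=> /rst_translation Rt o a b ab.
(* h k takes its first k arguments from b and the others from a *)
pose h k := fun j : 'I_(arity o) => if (j < k)%N then b j else a j.
have -> : b = h (arity o) by apply/funext => j; rewrite /h ltn_ord.
suff H k : (k <= arity o)%N -> clos_refl_sym_trans A G (op o a) (op o (h k)).
  exact: H.
elim: k => [_|k IH ko].
  have -> : h 0%N = a by apply/funext => j.
  exact: rst_refl.
apply: rst_trans (IH (ltnW ko)) _.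
pose i := Ordinal ko.
have -> : h k = update (h k) i (a i).
  apply/funext => j; rewrite /update /h; case: eqP => // ->.
  by rewrite ltnn.
have -> : h k.+1 = update (h k) i (b i).
  apply/funext => j; rewrite /update /h; case: eqP => [->|ji].
    by rewrite ltnSn.
  have jk : (j != k :> nat) by apply/eqP => e; apply: ji; apply: val_inj.
  by rewrite ltnS leq_eqVlt (negbTE jk).
exact: Rt.
Qed.

Definition rst_con (G : A -> A -> Prop) (Gt : translation_closed G) :
    congruence A :=
  @Congruence S A (clos_refl_sym_trans A G) (rst_refl A G) (rst_sym A G)
    (rst_trans A G) (rst_op Gt).

Lemma rst_saturated (T : Type) (G : T -> T -> Prop) (P : T -> Prop) :
  (forall x y, G x y -> P x <-> P y) ->
  forall x y, clos_refl_sym_trans T G x y -> P x <-> P y.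
Proof.
move=> GP x y; elim=> {x y} [|//|x y _ ->//|x y z _ -> _ ->//].
exact: GP.
Qed.

(** The join of congruences is reached by finite chains, each step of which lies
    in one of the congruences.  Saturated predicates give the induction along
    such chains. *)
Lemma con_sup_saturated (D : set (congruence A)) (P : A -> Prop) :
  (forall t, D t -> forall x y, t x y -> P x -> P y) ->
  forall x y, con_sup D x y -> P x -> P y.
Proof.
move=> DP x y xy.
pose G x y := exists2 t : congruence A, D t & t x y.
have Gt : translation_closed G.
  move=> o a i u v [t Dt uv]; exists t => //; apply: con_op => j.
  by rewrite /update; case: (j == i) => //; apply: con_refl.
suff -> : P x <-> P y by [].
apply: (@rst_saturated _ G P) => [u v [t Dt uv]|].
  by split; apply: DP Dt _ _ _ => //; apply: con_sym.
by apply: (xy (rst_con Gt)) => u v uv; apply: rst_step.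
Qed.

Lemma con_join_saturated (a b : congruence A) (P : A -> Prop) :
  (forall x y, a x y -> P x -> P y) -> (forall x y, b x y -> P x -> P y) ->
  forall x y, (a `|` b) x y -> P x -> P y.
Proof. by move=> aP bP; apply: con_sup_saturated => t [->|->]. Qed.

End Translations.

(** * Subalgebras of powers *)

Section Subpower.
Variables (S : signature) (A : algebra S) (I : Type) (B : set (I -> A)).
Hypothesis Bop : forall (o : symbol S) (a : 'I_(arity o) -> I -> A),
  (forall k, B (a k)) -> B (fun i => op o (fun k => a k i)).
Hypothesis B0 : exists f, B f.

Lemma subpower_nonempty : inhabited {f | B f}.
Proof. by have [f Bf] := B0; split; exists f. Qed.

Definition subpower : algebra S := {|
  carrier := {f | B f};
  op := fun o a => exist _ _ (Bop (fun k => proj2_sig (a k)));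
  carrier_nonempty := subpower_nonempty |}.

Definition coord (i : I) : hom subpower A :=
  @Hom S subpower A (fun f => proj1_sig f i) (fun _ _ => erefl).

Lemma subpower_ext (x y : subpower) :
  (forall i, coord i x = coord i y) -> x = y.
Proof. by case: x y => [x Bx] [y By] xy; apply: eq_exist; apply/funext. Qed.

Lemma variety_subpower (V : algebra S -> Prop) :
  variety V -> V A -> V subpower.
Proof.
move=> [E VE] /VE EA; apply/VE => e Ee v.
apply: subpower_ext => i.
by have := EA e Ee (fun n => coord i (v n)); rewrite -!eval_hom.
Qed.

End Subpower.

(** * Matrices and the term condition *)

Section Matrices.
Variables (S : signature) (A : algebra S).
Implicit Types (alpha beta delta eta : congruence A).

(** The usual matrices of commutator theory: [t u] is the upper row and [v w] the
    lower one, [alpha] relates vertically and [beta] horizontally. *)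
Inductive mat alpha beta : A -> A -> A -> A -> Prop :=
| mat_vert a b of alpha a b : mat alpha beta a a b b
| mat_horiz c d of beta c d : mat alpha beta c d c d
| mat_op (o : symbol S) (t u v w : 'I_(arity o) -> A) of
    (forall i, mat alpha beta (t i) (u i) (v i) (w i)) :
    mat alpha beta (op o t) (op o u) (op o v) (op o w).

Lemma mat_tr alpha beta t u v w :
  mat alpha beta t u v w -> mat beta alpha t v u w.
Proof.
elim=> {t u v w} [a b ab|c d cd|o t u v w _ IH].
- exact: mat_horiz.
- exact: mat_vert.
- exact: mat_op.
Qed.

Lemma mat_flip alpha beta t u v w :
  mat alpha beta t u v w -> mat alpha beta v w t u.
Proof.
elim=> {t u v w} [a b ab|c d cd|o t u v w _ IH].
- exact/mat_vert/con_sym.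
- exact: mat_horiz.
- exact: mat_op.
Qed.

Lemma mat_mono alpha alpha' beta beta' t u v w :
  alpha <= alpha' -> beta <= beta' ->
  mat alpha beta t u v w -> mat alpha' beta' t u v w.
Proof.
move=> /con_leP aa /con_leP bb; elim=> {t u v w} [a b ab|c d cd|o t u v w _ IH].
- exact/mat_vert/aa.
- exact/mat_horiz/bb.
- exact: mat_op.
Qed.

Lemma mat_con alpha beta t u v w : mat alpha beta t u v w ->
  [/\ alpha t v, alpha u w, beta t u & beta v w].
Proof.
elim=> {t u v w} [a b ab|c d cd|o t u v w _ IH].
- by split=> //; apply: con_refl.
- by split=> //; apply: con_refl.
- by split; apply: con_op => i; case: (IH i).
Qed.

(** The term condition C(alpha, beta; delta) of Freese and McKenzie. *)
Definition centralizes alpha beta delta : Prop :=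
  forall t u v w, mat alpha beta t u v w -> delta t u -> delta v w.

(** The term condition restricted to matrices with a constant upper row.  In this
    form it is visibly inherited by larger congruences [delta]. *)
Definition weakly_centralizes alpha beta delta : Prop :=
  forall t v w, mat alpha beta t t v w -> delta v w.

Lemma centralizes_weakly alpha beta delta :
  centralizes alpha beta delta -> weakly_centralizes alpha beta delta.
Proof. by move=> C t v w /C; apply; apply: con_refl. Qed.

Variables (V : algebra S -> Prop).
Hypotheses (V_variety : variety V) (V_modular : congruence_modular V).
Hypothesis AV : V A.

Definition mx (t u v w : A) (ij : bool * bool) : A :=
  match ij with
  | (false, false) => t | (false, true) => u
  | (true, false) => v | (true, true) => w
  end.

Section MatrixAlgebra.
Variables alpha beta : congruence A.

Definition mat_set : set (bool * bool -> A) :=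
  [set m | mat alpha beta (m (false, false)) (m (false, true))
                          (m (true, false)) (m (true, true))].

Lemma mat_set_op (o : symbol S) (a : 'I_(arity o) -> bool * bool -> A) :
  (forall k, mat_set (a k)) -> mat_set (fun i => op o (fun k => a k i)).
Proof. by move=> aM; apply: mat_op => i; apply: aM. Qed.

Lemma mat_set0 : exists m, mat_set m.
Proof.
case: (carrier_nonempty A) => e; exists (mx e e e e).
exact/mat_vert/con_refl.
Qed.

Definition mat_alg := subpower mat_set_op mat_set0.

Definition mat_mk t u v w (m : mat alpha beta t u v w) : mat_alg :=
  exist mat_set (mx t u v w) m.

Definition entry_con (delta : congruence A) i j : congruence mat_alg :=
  con_preim (coord mat_set_op mat_set0 (i, j)) delta.

End MatrixAlgebra.

(** This is the only use of modularity in the theory of matrices, and it takes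
    place in the congruence lattice of the algebra of matrices itself.  Given a
    matrix with rows [t u] and [v w] such that [delta t v], the matrices
<<
      u u        t u        t u        u u
      u u        t u        v w        w w
>>
    are successively related by having equal right columns, by having equal
    upper rows and [delta]-related lower left entries, and by having equal right
    columns.  The first and the last one have equal upper rows, so the modular
    law turns this path into one through matrices that all have upper row [u u].
    The weak term condition makes the lower row of each of these
    [delta]-related, hence the lower left entry never leaves its
    [delta]-class: it is [u] at the start and [w] at the end. *)
Lemma weakly_centralizes_sym alpha beta delta :
  weakly_centralizes alpha beta delta -> centralizes beta alpha delta.
Proof.
move=> X t v u w /mat_tr m tv.
have [atv auw btu bvw] := mat_con m.
pose B := mat_alg alpha beta.
have VB : V B by exact: (variety_subpower _ _ V_variety AV).
pose top_eq := entry_con alpha beta \bot false false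
           `&` entry_con alpha beta \bot false true.
pose right_eq := entry_con alpha beta \bot false true
           `&` entry_con alpha beta \bot true true.
pose top_eq_delta := top_eq `&` entry_con alpha beta delta true false.
pose U : B := mat_mk (mat_vert beta (con_refl alpha u)).
pose X0 : B := mat_mk (mat_horiz alpha btu).
pose Y : B := mat_mk m.
pose W : B := mat_mk (mat_vert beta auw).
have UW : ((top_eq_delta `|` right_eq) `&` top_eq) U W.
  apply/con_meetE; split; last by apply/con_meetE.
  have UX : right_eq U X0 by apply/con_meetE.
  have YW : right_eq Y W by apply/con_meetE.
  have XY : top_eq_delta X0 Y by apply/con_meetE; split; [apply/con_meetE|].
  apply: con_trans (con_joinr UX) _.
  by apply: con_trans (con_joinl XY) (con_joinr YW).
(* the path U, X0, Y, W becomes a path in which every node has upper row u u *)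
rewrite (V_modular VB) ?leIl // in UW.
pose P (n : B) := top_eq U n /\ delta (proj1_sig n (true, false)) u.
suff [_ /con_sym] : P W by [].
apply: (con_join_saturated _ _ UW); last first.
- by split; apply: con_refl.
- move=> x y /con_meetE[/con_meetE[_ rxy] txy] [Ux xu].
  have Uy := con_trans Ux txy; split=> //.
  have diag n : top_eq U n ->
      delta (proj1_sig n (true, false)) (proj1_sig n (true, true)).
    case: n => n nM /con_meetE[/= e1 e2]; apply: (X u).
    by have := nM; rewrite /mat_set /= -e1 -e2.
  apply: con_trans (diag _ Uy) _.
  have e : proj1_sig x (true, true) = proj1_sig y (true, true) := rxy.
  by rewrite -e; apply: con_trans (con_sym (diag _ Ux)) xu.
- move=> x y /con_meetE[txy dxy] [Ux xu]; split; first exact: con_trans Ux txy.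
  have : delta (proj1_sig x (true, false)) (proj1_sig y (true, false)) := dxy.
  by move=> /con_sym/con_trans; apply.
Qed.

(** Together with [weakly_centralizes_sym], the weak and the full term condition
    are equivalent and symmetric in the first two congruences. *)
Lemma centralizes_sym alpha beta delta :
  centralizes alpha beta delta -> centralizes beta alpha delta.
Proof. by move=> /centralizes_weakly/weakly_centralizes_sym. Qed.

Section Rows.
Variable beta : congruence A.

Definition row (x y : A) (i : bool) : A := if i then y else x.

Definition row_set : set (bool -> A) := [set r | beta (r false) (r true)].

Lemma row_set_op (o : symbol S) (a : 'I_(arity o) -> bool -> A) :
  (forall k, row_set (a k)) -> row_set (fun i => op o (fun k => a k i)).
Proof. by move=> aM; apply: con_op => i; apply: aM. Qed.

Lemma row_set0 : exists r, row_set r.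
Proof.
by case: (carrier_nonempty A) => e; exists (fun=> e); apply: con_refl.
Qed.

Definition row_alg := subpower row_set_op row_set0.

Definition row_mk x y (xy : beta x y) : row_alg := exist row_set (row x y) xy.

Definition row_rel alpha (r s : row_alg) : Prop :=
  mat alpha beta (proj1_sig r false) (proj1_sig r true)
                 (proj1_sig s false) (proj1_sig s true).

Lemma row_rel_translation alpha : translation_closed (row_rel alpha).
Proof.
apply: compatible_translation_closed => [[r rB]|o a b ab].
  exact: mat_horiz.
exact: mat_op.
Qed.

Lemma centralizes_saturated alpha delta (r s : row_alg) :
  centralizes alpha beta delta -> row_rel alpha r s ->
  delta (proj1_sig r false) (proj1_sig r true) <->
  delta (proj1_sig s false) (proj1_sig s true).
Proof. by move=> C rs; split; apply: C; [exact: rs|exact: mat_flip rs]. Qed.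

Lemma centralizes_le alpha delta :
  alpha <= delta -> centralizes alpha beta delta.
Proof.
move=> /con_leP ad t u v w /mat_con[/ad tv /ad uw _ _] tu.
exact: con_trans (con_sym tv) (con_trans tu uw).
Qed.

(** Read on rows, the term condition says that the set of [delta]-related rows is
    a union of classes of the congruence of [row_alg] generated by the matrices.
    For a join, that congruence is generated by the matrices of both parts,
    because the pairs with related constant rows form a congruence of [A]. *)
Lemma centralizes_joinl alpha eta delta :
  centralizes alpha beta delta -> centralizes eta beta delta ->
  centralizes (alpha `|` eta) beta delta.
Proof.
move=> Ca Ce t u v w m.
pose G r s := row_rel alpha r s \/ row_rel eta r s.
have Gt : translation_closed G.
  by move=> o a i x y [xy|xy]; [left|right]; apply: row_rel_translation.
pose Theta := rst_con Gt.
pose diag x := row_mk (con_refl beta x).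
have join_diag x y : (alpha `|` eta) x y -> Theta (diag x) (diag y).
  move=> H; apply: (con_join_saturated (P := fun z => Theta (diag x) (diag z))
    _ _ H); last exact: con_refl.
  - move=> p q pq xp; apply: con_trans xp _; apply: rst_step.
    by left; apply: mat_vert.
  - move=> p q pq xp; apply: con_trans xp _; apply: rst_step.
    by right; apply: mat_vert.
have : exists tu : beta t u, exists vw : beta v w,
    Theta (row_mk tu) (row_mk vw).
  elim: m => {t u v w} [a b ab|c d cd|o t u v w _ IH].
  - by exists (con_refl beta a), (con_refl beta b); apply: join_diag.
  - by exists cd, cd; apply: con_refl.
  - have tu i : beta (t i) (u i) by case: (IH i).
    have vw i : beta (v i) (w i) by case: (IH i) => ? [].
    exists (con_op tu), (con_op vw).
    suff -> : row_mk (con_op tu) = op o (fun i => row_mk (tu i)).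
      suff -> : row_mk (con_op vw) = op o (fun i => row_mk (vw i)).
        apply: con_op => i; have [tu' [vw' H]] := IH i.
        by rewrite (Prop_irrelevance (tu i) tu') (Prop_irrelevance (vw i) vw').
      by apply: eq_exist; apply/funext; case.
    by apply: eq_exist; apply/funext; case.
move=> [tu [vw H]].
suff [] : delta t u <-> delta v w by [].
apply: (rst_saturated
  (P := fun r : row_alg => delta (proj1_sig r false) (proj1_sig r true)) _ H).
by move=> r s [|]; exact: centralizes_saturated.
Qed.

End Rows.

(** The commutator of a congruence modular variety.  As it is generated by the weak
    term condition, every congruence above it satisfies that condition again. *)
Definition mat_commutator alpha beta : congruence A :=
  con_gen (fun v w => exists t, mat alpha beta t t v w).

Lemma mat_commutator_le alpha beta delta :
  mat_commutator alpha beta <= delta <-> weakly_centralizes alpha beta delta.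
Proof.
split=> [/con_leP H t v w m|H].
  by apply: H => s; apply; exists t.
by apply/con_leP => x y; apply => v w [t]; exact: H.
Qed.

Lemma mat_commutator_leI alpha beta :
  mat_commutator alpha beta <= alpha `&` beta.
Proof.
apply/mat_commutator_le => t v w /mat_con[tv tw _ vw].
by apply/con_meetE; split=> //; apply: con_trans (con_sym tv) tw.
Qed.

(** Since [eta] lies below the third congruence, it centralizes every congruence
    modulo the third one, so it can be joined to the first argument; by symmetry
    it can then be joined to the second. *)
Lemma centralizes_join alpha beta eta :
  centralizes (alpha `|` eta) (beta `|` eta) (mat_commutator alpha beta `|` eta).
Proof.
set delta := mat_commutator alpha beta `|` eta.
have ed gamma : centralizes eta gamma delta.
  by apply: centralizes_le; apply: leUr.
have : weakly_centralizes alpha beta delta.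
  by apply/mat_commutator_le; apply: leUl.
move=> /weakly_centralizes_sym/centralizes_sym.
move=> /centralizes_joinl/(_ (ed _))/centralizes_sym.
by move=> /centralizes_joinl/(_ (ed _))/centralizes_sym.
Qed.

End Matrices.

Lemma mat_image (S : signature) (A B : algebra S) (f : hom A B)
    (alpha beta : congruence A) t u v w : mat alpha beta t u v w ->
  mat (con_im f alpha) (con_im f beta) (f t) (f u) (f v) (f w).
Proof.
elim=> {t u v w} [a b ab|c d cd|o t u v w _ IH].
- by apply: mat_vert => s; apply; exists a, b.
- by apply: mat_horiz => s; apply; exists c, d.
- by rewrite !hom_op; apply: mat_op.
Qed.

(** Both congruences contain the kernel, so generators lift along [f]; lifts of the
    operations are chosen entry by entry. *)
Lemma mat_lift (S : signature) (A B : algebra S) (f : hom A B)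
    (alpha beta : congruence A) : surjective_hom f ->
  hom_ker f <= alpha -> hom_ker f <= beta ->
  forall t u v w, mat (con_im f alpha) (con_im f beta) t u v w ->
  exists m : A * A * (A * A), mat alpha beta m.1.1 m.1.2 m.2.1 m.2.2 /\
    [/\ f m.1.1 = t, f m.1.2 = u, f m.2.1 = v & f m.2.2 = w].
Proof.
move=> fs ka kb t u v w; elim=> {t u v w} [a b|c d|o t u v w _ /choice[m mP]].
- move=> /(con_imE fs ka)[x [y [xy <- <-]]].
  by exists (x, x, (y, y)); split=> //; apply: mat_vert.
- move=> /(con_imE fs kb)[x [y [xy <- <-]]].
  by exists (x, y, (x, y)); split=> //; apply: mat_horiz.
- exists (op o (fun i => (m i).1.1), op o (fun i => (m i).1.2),
          (op o (fun i => (m i).2.1), op o (fun i => (m i).2.2))).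
  split; first by apply: mat_op => i; case: (mP i).
  by split; rewrite hom_op; congr op; apply/funext => i; case: (mP i) => _ [].
Qed.

(** * The commutator axioms, and triviality of abelian algebras *)

Section CommutatorTop.
Variables (S : signature) (V : algebra S -> Prop).
Hypotheses (V_variety : variety V) (V_modular : congruence_modular V).
Hypothesis V_semideg : semidegenerate V.

(** A matrix over [B] with constant upper row lifts to a matrix over [A] whose upper
    row is in the kernel only; this is why the full term condition of
    [centralizes_join] is needed here. *)
Lemma mat_commutator_axioms : commutator_axioms V (@mat_commutator S).
Proof.
move=> A B f AV BV fs alpha beta; split; first exact: mat_commutator_leI.
set eta := hom_ker f; set delta := mat_commutator alpha beta `|` eta.
set a := alpha `|` eta; set b := beta `|` eta.
apply/le_anti/andP; split.
  rewrite leUx; apply/andP; split; last first.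
    apply/con_leP => x y xy; have e : f x = f y := xy.
    suff : mat_commutator (con_im f a) (con_im f b) (f x) (f y) by [].
    by rewrite e; apply: con_refl.
  apply/mat_commutator_le => t v w m.
  suff m' : mat (con_im f a) (con_im f b) (f t) (f t) (f v) (f w).
    by move=> s; apply; exists (f t).
  exact: mat_image (mat_mono (leUl _ _) (leUl _ _) m).
have ed : eta <= delta by apply: leUr.
have sub : mat_commutator (con_im f a) (con_im f b) <= con_im f delta.
  apply/mat_commutator_le => t v w.
  move=> /(mat_lift fs (leUr _ _) (leUr _ _))[[[t1 t2] [v1 w1]]].
  move=> /= [m [e1 e2 <- <-]] s; apply; exists v1, w1; split=> //.
  apply: (centralizes_join V_variety V_modular AV m).
  by apply: con_joinr; rewrite /= e1 e2.
apply/con_leP => x y xy.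
have /(con_imE fs ed)[x' [y' [d ex ey]]] := con_leP _ _ sub _ _ xy.
have H z z' : f z = f z' -> delta z z' by move=> e; apply: (con_leP _ _ ed).
by apply: con_trans (con_trans d _); apply: H.
Qed.

(** If [Q] is abelian then the diagonal is a single class of the congruence of the
    square of [Q] generated by identifying all diagonal pairs.  In the quotient it
    becomes a one-element subalgebra, so by semidegeneracy the quotient is
    trivial, and every pair is diagonal. *)
Lemma abelian_trivial (Q : algebra S) : V Q ->
  @mat_commutator S Q \top \top <= \bot -> forall x y : Q, x = y.
Proof.
move=> QV /mat_commutator_le X x y; apply: contrapT => nxy.
have C : centralizes \top \top (\bot : congruence Q).
  exact/(centralizes_sym V_variety V_modular QV)
       /(weakly_centralizes_sym V_variety V_modular QV).
pose R := row_alg (\top : congruence Q).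
have RV : V R by exact: (variety_subpower _ _ V_variety QV).
pose Theta := rst_con (@row_rel_translation S Q \top \top).
pose mk (x y : Q) : R := row_mk (I : (\top : congruence Q) x y).
have diag (r s : R) : Theta r s ->
    proj1_sig r false = proj1_sig r true <->
    proj1_sig s false = proj1_sig s true.
  move=> H.
  apply: (rst_saturated
    (P := fun r : R =>
      (\bot : congruence Q) (proj1_sig r false) (proj1_sig r true)) _ H).
  by move=> p q; exact: centralizes_saturated.
have diag_mk u v : Theta (mk u u) (mk v v) by apply/rst_step/mat_vert.
have nontriv : exists p q : quot Theta, p <> q.
  exists (quot_pi Theta (mk x x)), (quot_pi Theta (mk x y)) => /quot_piP/diag.
  by move=> [/(_ erefl)].
apply: (V_semideg (variety_quot Theta V_variety RV) nontriv
  (e := quot_pi Theta (mk x x))) => o a ae.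
have -> : a = fun=> quot_pi Theta (mk x x) by apply/funext.
apply: etrans (esym (quot_pi_op Theta (fun _ : 'I_(arity o) => mk x x))) _.
apply/quot_piP.
suff -> : op o (fun=> mk x x) = mk (op o (fun=> x)) (op o (fun=> x)) by [].
by apply: eq_exist; apply/funext; case.
Qed.

End CommutatorTop.

(** * Directed joins and maximal congruences *)

Section Compactness.
Variables (S : signature) (A : algebra S).
Implicit Types (alpha beta : congruence A) (D : set (congruence A)).

Definition directed D : Prop :=
  (exists a, D a) /\
  forall a b, D a -> D b -> exists c, [/\ D c, a <= c & b <= c].

Lemma le_con_sup D t : D t -> t <= con_sup D.
Proof. exact: (con_supP D (con_sup D)).1. Qed.

Lemma compact_directed alpha D : compact A alpha -> directed D ->
  alpha <= con_sup D -> exists2 t, D t & alpha <= t.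
Proof.
move=> ca [[t0 Dt0] Ddir] /ca[F [/finite_seqP[s ->] sD sup]].
suff [t Dt st] : exists2 t, D t & forall u, u \in s -> u <= t.
  exists t => //; apply: le_trans sup _; apply/con_supP => u; exact: st.
elim: s sD {sup} => [|u s IH] sD; first by exists t0.
have [|t Dt st] := IH; first by move=> v vs; apply: sD; rewrite /= inE vs orbT.
have [|c [Dc uc tc]] := Ddir u t _ Dt; first by apply: sD; rewrite /= inE eqxx.
exists c => // v; rewrite inE => /orP[/eqP->//|/st vt].
exact: le_trans vt tc.
Qed.

Lemma compact_principal x y :
  compact A (con_gen (fun u v => exists2 i : unit, u = x & v = y)).
Proof. exact: (@compact_con_gen S A unit (fun=> x) (fun=> y)). Qed.

Lemma le_compactP alpha beta :
  (forall gamma, compact A gamma -> gamma <= alpha -> gamma <= beta) ->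
  alpha <= beta.
Proof.
move=> H; apply/con_leP => x y axy.
have /con_leP : con_gen (fun u v => exists2 i : unit, u = x & v = y) <= beta.
  apply: H; first exact: compact_principal.
  by apply/con_leP => u v; apply => _ _ [_ -> ->].
by apply=> t; apply; exists tt.
Qed.

(** Compactness of the top congruence keeps joins of chains proper. *)
Lemma exists_maximal (phi0 : congruence A) : compact A \top -> phi0 <> \top ->
  exists phi, [/\ phi0 <= phi, phi <> \top &
    forall psi, phi <= psi -> psi <> \top -> psi = phi].
Proof.
move=> K1 phi0P.
pose T := {phi : congruence A | phi0 <= phi /\ phi <> \top}.
pose R (a b : T) : bool := proj1_sig a <= proj1_sig b.
have sigE (a b : T) : proj1_sig a = proj1_sig b -> a = b.
  by case: a b => [a ?] [b ?]; apply: eq_exist.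
have [||| C Ctot|[phi [le0 phiP]] max] := @Zorn T R.
- by move=> a; apply: lexx.
- by move=> a b c; apply: le_trans.
- by move=> a b ab ba; apply: sigE; apply/le_anti/andP.
- have [[c0 Cc0]|C0] := pselect (exists c, C c); last first.
    by exists (exist _ phi0 (conj (lexx _) phi0P)) => s Cs; case: C0; exists s.
  pose D := [set phi | exists2 c : T, C c & phi = proj1_sig c].
  have Ddir : directed D.
    split; first by exists (proj1_sig c0), c0.
    move=> _ _ [a Ca ->] [b Cb ->]; case: (Ctot a b Ca Cb) => ab.
      by exists (proj1_sig b); split=> //; exists b.
    by exists (proj1_sig a); split=> //; exists a.
  have Dc0 : D (proj1_sig c0) by exists c0.
  have supP : phi0 <= con_sup D /\ con_sup D <> \top.
    split; first by apply: le_trans (le_con_sup Dc0); case: (proj2_sig c0).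
    move=> e; have [|t [c Cc ->]] := compact_directed K1 Ddir.
      by rewrite e.
    by rewrite le1x => /eqP; case: (proj2_sig c).
  by exists (exist _ (con_sup D) supP) => s Cs; apply: le_con_sup; exists s.
- exists phi; split=> // psi le1 psiP.
  have H : phi0 <= psi /\ psi <> \top by split=> //; apply: le_trans le1.
  by have /(congr1 (@proj1_sig _ _)) := max (exist _ psi H) le1.
Qed.

End Compactness.

(** * Prime congruences and radicals *)

Section Primes.
Variables (S : signature) (V : algebra S -> Prop).
Hypotheses (V_variety : variety V) (V_modular : congruence_modular V).
Hypothesis V_semideg : semidegenerate V.
Variables (A : algebra S) (AV : V A).
Implicit Types (alpha beta e phi theta : congruence A).

Lemma quot_hom_surjective phi : surjective_hom (quot_hom phi).
Proof. by move=> b; exists (quot_repr b); apply: quot_reprK. Qed.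

Lemma hom_ker_quot phi : hom_ker (quot_hom phi) = phi.
Proof. by apply: con_ext => x y; apply: quot_piP. Qed.

(** If neither [alpha] nor [beta] is below the maximal [phi], both become the top
    congruence modulo [phi]; the homomorphism property of the commutator would
    then make the quotient by [phi] abelian, hence trivial. *)
Lemma maximal_prime phi : phi <> \top ->
  (forall psi, phi <= psi -> psi <> \top -> psi = phi) ->
  prime_congruence V phi.
Proof.
move=> phiP max; split=> // alpha beta ab; apply: contrapT.
move=> /not_orP[na nb].
have join_top gamma : ~ gamma <= phi -> gamma `|` phi = \top.
  move=> ng; apply: contrapT => np; apply: ng.
  by rewrite -(max (gamma `|` phi)) ?leUl ?leUr.
have VQ := variety_quot phi V_variety AV.
have [C _] := commutatorP V.
have [_] := C A (quot phi) (quot_hom phi) AV VQ (@quot_hom_surjective phi)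
  alpha beta.
rewrite hom_ker_quot (join_top _ na) (join_top _ nb) (join_idPr ab).
have -> : con_im (quot_hom phi) \top = \top.
  apply: con_ext => u v; split=> // _.
  have [x <-] := quot_hom_surjective u; have [y <-] := quot_hom_surjective v.
  by move=> s; apply; exists x, y.
set c := commutator V _ _ => cphi.
have tc_le : @mat_commutator S (quot phi) \top \top <= c.
  by apply: commutator_ub; apply: mat_commutator_axioms.
have c0 : c <= \bot.
  apply/con_leP => u v.
  have [x <-] := quot_hom_surjective u; have [y <-] := quot_hom_surjective v.
  move=> cxy; apply/quot_piP; rewrite cphi; exact: cxy.
apply: phiP; apply: con_ext => x y; split=> // _; apply/quot_piP.
exact: (abelian_trivial V_variety V_modular V_semideg VQ (le_trans tc_le c0)).
Qed.

Lemma exists_prime theta : theta <> \top ->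
  exists2 phi, prime_congruence V phi & theta <= phi.
Proof.
move=> /(exists_maximal (compact_nabla V_variety V_semideg AV)).
by move=> [phi [le phiP max]]; exists phi => //; apply: maximal_prime.
Qed.

Lemma le_radical theta : theta <= radical V theta.
Proof. by apply/con_infP => phi []. Qed.

Lemma radical_le_prime theta phi :
  prime_congruence V phi -> theta <= phi -> radical V theta <= phi.
Proof. by move=> P le; move: (lexx (radical V theta)) => /con_infP; apply. Qed.

Lemma radical_top theta : radical V theta = \top -> theta = \top.
Proof.
move=> rt; apply: contrapT => /exists_prime[phi P le].
by case: (P) => + _; apply; apply/eqP; rewrite -le1x -rt radical_le_prime.
Qed.

Hypothesis A_semiprime : semiprime V A.

Lemma le_bot_prime theta :
  (forall phi, prime_congruence V phi -> theta <= phi) -> theta = \bot.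
Proof.
move=> H; apply/eqP; rewrite -lex0 -A_semiprime.
by apply/con_infP => phi [P _]; apply: H.
Qed.

Lemma prime_meet phi alpha beta : prime_congruence V phi ->
  alpha `&` beta <= phi -> alpha <= phi \/ beta <= phi.
Proof.
move=> P le; apply: (prime_comm AV _ _ P).1.
exact: le_trans (commutator_leI _ _ AV) le.
Qed.

(** A prime contains [e] or its complement [f], and in the first case it contains
    the radical of [e].  So the radical of [e] meets [f] trivially and
    contains [e], and in a modular lattice comparable elements with a common
    complement coincide. *)
Lemma complemented_radical e : complemented e -> radical V e = e.
Proof.
move=> [f [ef0 ef1]]; apply/le_anti; rewrite le_radical andbT.
have re0 : f `&` radical V e = \bot.
  apply: le_bot_prime => phi P.
  have : e `&` f <= phi by rewrite ef0 le0x.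
  move=> /(prime_meet P)[/(radical_le_prime P)|] le.
    by rewrite (le_trans _ le) ?leIr.
  by rewrite (le_trans _ le) ?leIl.
have := V_modular AV f (le_radical e).
by rewrite ef1 meet1x re0 joinx0 => ->.
Qed.

(** Compactness of the top congruence gives a compact [x] below [e] that already
    joins with the complement of [e] to the top; modularity forces [x = e]. *)
Lemma complemented_compact e : complemented e -> compact A e.
Proof.
move=> [f [ef0 ef1]].
pose D := [set t | exists x, [/\ compact A x, x <= e & t = x `|` f]].
have Ddir : directed D.
  split; first by exists (\bot `|` f), \bot; split=> //; apply: compact_bot.
  move=> _ _ [x [cx xe ->]] [y [cy ye ->]].
  exists ((x `|` y) `|` f); split; last 2 first.
  - by rewrite leU2 ?leUl.
  - by rewrite leU2 ?leUr.
  by exists (x `|` y); split=> //; [apply: compact_join|rewrite leUx xe].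
have D1 : \top <= con_sup D.
  rewrite -ef1 leUx; apply/andP; split.
    apply: le_compactP => x cx xe; apply: le_trans (leUl x f) _.
    by apply: le_con_sup; exists x.
  apply: le_trans (leUr f \bot) _; apply: le_con_sup.
  by exists \bot; split=> //; apply: compact_bot.
have [_ [x [cx xe ->]]] :=
  compact_directed (compact_nabla V_variety V_semideg AV) Ddir D1.
rewrite le1x => /eqP xf.
suff -> : e = x by [].
have := V_modular AV f xe.
by rewrite xf meet1x meetC ef0 joinx0.
Qed.

End Primes.

(** * Regular congruences and regular ideals *)

Section Regular.
Variables (S : signature) (V : algebra S -> Prop).
Hypotheses (V_variety : variety V) (V_modular : congruence_modular V).
Hypothesis V_semideg : semidegenerate V.
Variables (A : algebra S) (AV : V A).
Hypotheses (A_semiprime : semiprime V A) (KC : compact_commutator V A).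
Local Notation K1 := (compact_nabla V_variety V_semideg AV).
Local Notation L := (reticulation AV KC K1).
Local Notation lam := (lambda AV KC K1 : kcon A -> L).
Implicit Types (e f theta : congruence A) (a b : kcon A) (I : set L).

Lemma lambda_surj (x : L) : exists a, x = lam a.
Proof. by exists (repr x); rewrite /lambda reprK. Qed.

Lemma lambda_le a b : (lam a <= lam b) <-> (val a <= radical V (val b)).
Proof.
split=> [le|le].
  apply/con_infP => phi [P bphi].
  have /ret_leP/(_ phi P) := le; rewrite !prime_lambda //; exact.
apply/ret_leP => phi P; rewrite !prime_lambda // => bphi.
exact: le_trans le (radical_le_prime P bphi).
Qed.

(** From left to right, disjointness comes from semiprimeness, and the join is the
    top because no prime contains it. *)
Lemma lambda_complemented a :
  complemented (lam a) <-> complemented (val a).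
Proof.
split=> [[y]|[f [ef0 ef1]]].
  have [b ->] := lambda_surj y; rewrite lambda_meet lambda_join.
  rewrite lambda_bot lambda_top => -[/lambda_eqP /= m0 /lambda_eqP /= j1].
  exists (val b); split.
    apply: (le_bot_prime A_semiprime) => phi P.
    have : commutator V (val a) (val b) <= phi.
      apply: le_trans (le_radical V _) _; rewrite m0.
      by apply: radical_le_prime => //; apply: le0x.
    move=> /(prime_comm AV _ _ P)[] le.
      by rewrite (le_trans _ le) ?leIl.
    by rewrite (le_trans _ le) ?leIr.
  apply: (radical_top V_variety V_modular V_semideg AV); rewrite j1.
  by apply/eqP; rewrite -le1x le_radical.
have cf : compact A f.
  apply: (complemented_compact V_variety V_modular V_semideg AV).
  by exists (val a); rewrite meetC joinC.
exists (lam (kmk cf)); rewrite lambda_meet lambda_join lambda_bot lambda_top.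
split; apply/lambda_eqP => /=; congr (radical V _) => //.
by apply/eqP; rewrite -lex0 -ef0 commutator_leI.
Qed.

Lemma complemented_ret_join (x y : L) :
  complemented x -> complemented y -> complemented (x `|` y).
Proof.
move=> [x' [x0 x1]] [y' [y0 y1]]; exists (x' `&` y'); split.
  by rewrite meetUl meetA x0 meet0x meetCA y0 meetx0 joinx0.
by rewrite joinIr joinAC x1 join1x -joinA y1 joinx1 meetxx.
Qed.

(** In a modular lattice complemented elements need not be closed under joins; here
    closure is imported from the distributive lattice [L]. *)
Lemma complemented_con_join e f :
  complemented e -> complemented f -> complemented (e `|` f).
Proof.
move=> eB fB.
have ce := complemented_compact V_variety V_modular V_semideg AV eB.
have cf := complemented_compact V_variety V_modular V_semideg AV fB.
have : complemented (lam (kmk ce) `|` lam (kmk cf)).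
  by apply: complemented_ret_join; apply/lambda_complemented.
by rewrite lambda_join => /lambda_complemented.
Qed.

Lemma complemented_bot (d : Order.disp_t) (M : tbLatticeType d) :
  complemented (\bot : M).
Proof. by exists \top; rewrite meet0x join0x. Qed.

Definition complemented_below theta : set (congruence A) :=
  [set e | complemented e /\ e <= theta].

Lemma complemented_below_directed theta : directed (complemented_below theta).
Proof.
split; first by exists \bot; split; [apply: complemented_bot|apply: le0x].
move=> e f [eB le] [fB lf]; exists (e `|` f); rewrite leUl leUr; split=> //.
by split; [apply: complemented_con_join|rewrite leUx le].
Qed.

Lemma regular_congruenceP theta :
  regular_congruence theta <-> theta = con_sup (complemented_below theta).
Proof.
split=> [[D DB ->]|e]; last by exists (complemented_below theta) => // e' [].
apply/le_anti/andP; split.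
  by apply: con_sup_mono => t Dt; split; [apply: DB|apply: le_con_sup].
by apply/con_supP => t [].
Qed.

Lemma regular_congruence_compact theta alpha : regular_congruence theta ->
  compact A alpha -> alpha <= theta ->
  exists e, [/\ complemented e, e <= theta & alpha <= e].
Proof.
move=> /regular_congruenceP e ca; rewrite {1}e.
move=> /(compact_directed ca (complemented_below_directed theta))[f []].
by exists f.
Qed.

(** Complemented elements of [L] are closed under finite joins, so the elements
    below a complemented member of an ideal themselves form an ideal. *)
Lemma regular_idealP I : regular_ideal I <->
  ideal I /\ forall x, I x -> exists y, [/\ complemented y, I y & x <= y].
Proof.
split=> [[X XB ->]|[Iid IB]].
  have Gid : ideal (ideal_gen X).
    split=> [J [J0 _ _] _//|x y xG yG J Jid XJ|x y xy yG J Jid XJ].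
      by case: (Jid) => _ + _; apply; [apply: xG|apply: yG].
    by case: (Jid) => _ _; apply; [exact: xy|apply: yG].
  split=> // x.
  move/(_ [set x | exists y, [/\ complemented y, ideal_gen X y & x <= y]]); apply.
    split=> [|u v|u v].
    - by exists \bot; split=> //; [apply: complemented_bot|case: Gid].
    - move=> [y [yB yG uy]] [z [zB zG vz]]; exists (y `|` z); split.
      + exact: complemented_ret_join.
      + by case: Gid => _ + _; apply.
      + exact: leU2.
    - by move=> uv [y [yB yG vy]]; exists y; split=> //; apply: le_trans vy.
  by move=> y Xy; exists y; split=> //; [apply: XB|move=> J _; apply].
exists [set y | complemented y /\ I y]; first by move=> y [].
apply/seteqP; split=> x.
  move=> /IB[y [yB Iy xy]] J [_ _ Jdown] XJ.
  by apply: Jdown xy _; apply: XJ.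
by apply=> // y [].
Qed.

(** Whether a compact congruence lies below a regular one depends on its class in
    [L] only, since the complemented congruences in between are radical. *)
Lemma regular_congruence_lambda theta a b : regular_congruence theta ->
  lam a <= lam b -> val b <= theta -> val a <= theta.
Proof.
move=> reg /lambda_le ab btheta.
have [e [eB etheta be]] := regular_congruence_compact reg (@kconP _ _ b) btheta.
apply: le_trans etheta; apply: (le_trans ab).
rewrite -(complemented_radical V_modular AV A_semiprime eB).
apply/radical_le => phi P; exact: le_trans.
Qed.

Local Notation star := (upper_star AV KC K1).

Lemma starP theta a : regular_congruence theta ->
  star theta (lam a) <-> val a <= theta.
Proof.
move=> reg; split=> [[b btheta e]|atheta]; last by exists a.
by apply: regular_congruence_lambda reg _ btheta; rewrite e.
Qed.

Lemma star_regular theta : regular_congruence theta -> regular_ideal (star theta).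
Proof.
move=> reg; apply/regular_idealP; split.
  split=> [|x y|x y].
  - by exists (kbot A) => //; apply: le0x.
  - move=> [a atheta ->] [b btheta ->]; rewrite lambda_join.
    by exists (kjoin a b) => //=; rewrite leUx atheta.
  - have [a ->] := lambda_surj x; have [b ->] := lambda_surj y.
    move=> ab /(starP _ reg) btheta; apply/(starP _ reg).
    exact: regular_congruence_lambda reg ab btheta.
move=> _ [a atheta ->].
have [e [eB etheta ae]] := regular_congruence_compact reg (@kconP _ _ a) atheta.
have ce := complemented_compact V_variety V_modular V_semideg AV eB.
exists (lam (kmk ce)); split.
- exact/lambda_complemented.
- by exists (kmk ce).
- by apply/lambda_le; apply: le_trans ae (le_radical V _).
Qed.

Lemma regular_ideal_complemented I a : regular_ideal I -> I (lam a) ->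
  exists e : kcon A, [/\ complemented (val e), I (lam e) & val a <= val e].
Proof.
move=> /regular_idealP[_ IB] /IB[y []].
have [e ->] := lambda_surj y => eB Ie /lambda_le ae.
have {}eB : complemented (val e) by apply/lambda_complemented.
exists e; split=> //.
by rewrite -(complemented_radical V_modular AV A_semiprime eB).
Qed.

Lemma lower_star_regular I : regular_ideal I -> regular_congruence (lower_star I).
Proof.
move=> reg.
exists [set alpha | complemented alpha /\
      exists2 e : kcon A, I (lam e) & alpha = val e].
  by move=> t [].
apply/le_anti/andP; split; apply/con_supP.
  move=> _ [a Ia ->]; have [e [eB Ie ae]] := regular_ideal_complemented reg Ia.
  by apply: le_trans ae _; apply: le_con_sup; split=> //; exists e.
by move=> _ [_ [e Ie ->]]; apply: le_con_sup; exists e.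
Qed.

Lemma lower_starP I a : regular_ideal I -> val a <= lower_star I <-> I (lam a).
Proof.
move=> reg; have [[I0 IU Idown] _] := (regular_idealP I).1 reg.
split=> [|Ia]; last by apply: le_con_sup; exists a.
move=> /(compact_directed (@kconP _ _ a))[].
  split; first by exists \bot, (kbot A).
  move=> _ _ [b Ib ->] [c Ic ->]; exists (val b `|` val c).
  rewrite leUl leUr; split=> //; exists (kjoin b c) => //.
  by rewrite -lambda_join; apply: IU.
move=> _ [b Ib ->] ab; apply: Idown Ib; apply/lambda_le.
exact: le_trans ab (le_radical V _).
Qed.

Lemma lower_star_star theta : regular_congruence theta ->
  lower_star (star theta) = theta.
Proof.
move=> reg; have sreg := star_regular reg.
apply/le_anti/andP; split; apply: le_compactP => alpha ca ale.
  by apply/(starP (kmk ca) reg)/(lower_starP _ sreg).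
by apply/(lower_starP (kmk ca) sreg)/(starP _ reg).
Qed.

Lemma star_lower_star I : regular_ideal I -> star (lower_star I) = I.
Proof.
move=> reg; have lreg := lower_star_regular reg.
apply/seteqP; split=> x; have [a ->] := lambda_surj x.
  by move=> /(starP _ lreg)/(lower_starP _ reg).
by move=> Ia; apply/(starP _ lreg)/(lower_starP _ reg).
Qed.

Lemma star_mono theta theta' : theta <= theta' -> subset (star theta) (star theta').
Proof. by move=> le _ [a ale ->]; exists a => //; apply: le_trans le. Qed.

Lemma lower_star_mono I J : subset I J -> lower_star I <= lower_star J.
Proof. by move=> IJ; apply: con_sup_mono => _ [a /IJ Ja ->]; exists a. Qed.

Lemma star_top : star \top = setT.
Proof.
apply/seteqP; split=> // x _; have [a ->] := lambda_surj x.
by exists a => //; apply: lex1.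
Qed.

Lemma lower_star_setT : lower_star (setT : set L) = \top.
Proof.
by apply/eqP; rewrite -le1x; apply: le_con_sup; exists (ktop K1).
Qed.

Lemma star_proper theta :
  proper_regular_congruence theta -> proper_regular_ideal (star theta).
Proof.
move=> [reg ntop]; split; first exact: star_regular.
by move=> e; apply: ntop; rewrite -(lower_star_star reg) e lower_star_setT.
Qed.

Lemma lower_star_proper I :
  proper_regular_ideal I -> proper_regular_congruence (lower_star I).
Proof.
move=> [reg nT]; split; first exact: lower_star_regular.
by move=> e; apply: nT; rewrite -(star_lower_star reg) e star_top.
Qed.

(** By [lower_star_star] and [star_lower_star] the two maps are mutually inverse
    monotone bijections between proper regular congruences and proper regular
    ideals, so they preserve maximality. *)
Lemma star_max_regular theta :
  max_regular_congruence theta -> max_regular_ideal (star theta).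
Proof.
move=> [tP tmax]; split; first exact: star_proper.
move=> J JP tJ; rewrite -(star_lower_star JP.1); congr (star _).
apply: tmax; first exact: lower_star_proper.
by rewrite -(lower_star_star tP.1); apply: lower_star_mono.
Qed.

Lemma lower_star_max_regular I :
  max_regular_ideal I -> max_regular_congruence (lower_star I).
Proof.
move=> [IP Imax]; split; first exact: lower_star_proper.
move=> theta tP It; rewrite -(lower_star_star tP.1); congr lower_star.
apply: Imax; first exact: star_proper.
by rewrite -(star_lower_star IP.1); apply: star_mono.
Qed.

End Regular.

Theorem proposition6p20 (S : signature) (V : algebra S -> Prop)
    (V_variety : variety V) (V_modular : congruence_modular V)
    (V_semideg : semidegenerate V)
    (A : algebra S) (AV : V A)
    (A_semiprime : semiprime V A)
    (KC : compact_commutator V A) :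
  (forall theta : congruence A,
     max_regular_congruence theta ->
     max_regular_ideal
       (upper_star AV KC (compact_nabla V_variety V_semideg AV) theta)) /\
  (forall I : set (reticulation AV KC (compact_nabla V_variety V_semideg AV)),
     max_regular_ideal I -> max_regular_congruence (lower_star I)).
Proof.
split=> [theta|I]; first exact: star_max_regular.
exact: lower_star_max_regular.
Qed.
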